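(* For graphs $G_1,\ldots,G_d$ with $|V(G_i)| = q_i$ and $\mathrm{cubicity}(G_i) = c_i$ for each $i\in[d]$, $$\mathrm{boxicity}\left(\Box_{i=1}^d G_i\right) \leq \max_{i\in[d]} c_i + \mathrm{boxicity}\left(\Box_{i=1}^d K_{q_i}\right)$$ and $$\mathrm{cubicity}\left(\Box_{i=1}^d G_i\right) \leq \max_{i\in[d]} c_i + \mathrm{cubicity}\left(\Box_{i=1}^d K_{q_i}\right).$$
   Context: All graphs are finite, undirected and simple. $[d]=\{1,\ldots,d\}$ and $K_n$ is the complete graph on $n$ vertices. A $k$-box is a Cartesian product of $k$ closed intervals of $\mathbb{R}$, and a $k$-cube is a Cartesian product of $k$ closed intervals of unit length. A $k$-box ($k$-cube) representation of a graph $G$ is a function $f$ mapping each vertex to a $k$-box ($k$-cube) such that for any two distinct vertices $u,v$, $uv\in E(G)$ if and only if $f(u)\cap f(v)\neq\emptyset$. The boxicity (cubicity) of $G$ is the smallest natural number $k$ (with $0$ allowed; complete graphs have boxicity and cubicity $0$) such that $G$ has a $k$-box ($k$-cube) representation. The Cartesian product $G_1\Box G_2$ is the graph on $V(G_1)\times V(G_2)$ in which $(u_1,u_2)$ and $(v_1,v_2)$ are adjacent iff ($u_1=v_1$ and $u_2v_2\in E(G_2)$) or ($u_1v_1\in E(G_1)$ and $u_2=v_2$). $\Box_{i=1}^d$ denotes the iterated Cartesian product. *)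

(* Defs.v *)
From HB Require Import structures.
From mathcomp Require Import all_boot all_order all_algebra.
From mathcomp Require Import boolp classical_sets reals.
From mathcomp Require Import lra.

Set Implicit Arguments.
Unset Strict Implicit.
Unset Printing Implicit Defensive.

Import Order.TTheory GRing.Theory Num.Theory.

Local Open Scope ring_scope.
Local Open Scope classical_set_scope.

Record sgraph := SGraph {
  vertex :> finType;
  adj : rel vertex;
  adj_sym : symmetric adj;
  adj_irr : irreflexive adj }.

Arguments adj {s} u v.

Section Complete.
Variable n : nat.

Definition complete_adj : rel 'I_n := fun i j => i != j.

Lemma complete_adj_sym : symmetric complete_adj.
Proof. by move=> i j; rewrite /complete_adj eq_sym. Qed.

Lemma complete_adj_irr : irreflexive complete_adj.
Proof. by move=> i; rewrite /complete_adj eqxx. Qed.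

Definition complete : sgraph := SGraph complete_adj_sym complete_adj_irr.

End Complete.

Section CartesianProduct.
Variables G1 G2 : sgraph.

Definition cart_adj : rel (vertex G1 * vertex G2)%type := fun u v =>
  ((u.1 == v.1) && adj u.2 v.2) || (adj u.1 v.1 && (u.2 == v.2)).

Lemma cart_adj_sym : symmetric cart_adj.
Proof.
move=> u v; rewrite /cart_adj (adj_sym u.1) (adj_sym u.2).
by rewrite (eq_sym u.1) (eq_sym u.2).
Qed.

Lemma cart_adj_irr : irreflexive cart_adj.
Proof. by move=> u; rewrite /cart_adj !adj_irr andbF. Qed.

Definition cart : sgraph := SGraph cart_adj_sym cart_adj_irr.

End CartesianProduct.

(* The iteration associates to the right and starts from the one-vertex graph
   [complete 1], which is neutral for [cart] up to isomorphism. *)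
Definition bigcart (d : nat) (G : 'I_d -> sgraph) : sgraph :=
  \big[cart/complete 1]_(i < d) G i.

Section Representations.
Variable R : realType.

(* The condition [a 0 j <= b 0 j] excludes empty intervals.  For [k = 0] the
   only box is the single point of R^0, so a graph has a 0-box representation
   exactly when it is complete. *)
Definition is_box (k : nat) (B : set 'rV[R]_k) : Prop :=
  exists a b : 'rV[R]_k,
    (forall j, a 0 j <= b 0 j) /\
    B = [set x | forall j, a 0 j <= x 0 j <= b 0 j].

Definition is_cube (k : nat) (B : set 'rV[R]_k) : Prop :=
  exists a : 'rV[R]_k, B = [set x | forall j, a 0 j <= x 0 j <= a 0 j + 1].

Variable G : sgraph.

Definition intersection_rep (k : nat) (f : G -> set 'rV[R]_k) : Prop :=
  forall u v : G, u != v -> (adj u v <-> f u `&` f v !=set0).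

Definition has_box_rep (k : nat) : Prop :=
  exists f : G -> set 'rV[R]_k, (forall v, is_box (f v)) /\ intersection_rep f.

Definition has_cube_rep (k : nat) : Prop :=
  exists f : G -> set 'rV[R]_k, (forall v, is_cube (f v)) /\ intersection_rep f.

Lemma is_cube_box k (B : set 'rV[R]_k) : is_cube B -> is_box B.
Proof.
case=> a ->; exists a, (\row_j (a 0 j + 1)); split=> [j|].
  by rewrite mxE lerDl ler01.
by apply/seteqP; split=> x /= xa j; have := xa j; rewrite mxE.
Qed.

Lemma has_cube_box_rep k : has_cube_rep k -> has_box_rep k.
Proof. by case=> f [fc fi]; exists f; split=> // v; apply/is_cube_box/fc. Qed.

(* One coordinate per vertex w: its interval starts at 0, those of its
   neighbours at 1 and those of the other vertices at 2. *)
Lemma has_cube_rep_card : has_cube_rep #|G|.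
Proof.
pose p (w v : G) : R := if w == v then 0 else if adj w v then 1 else 2.
pose a v : 'rV[R]_#|G| := \row_j p (enum_val j) v.
exists (fun v => [set x | forall j, a v 0 j <= x 0 j <= a v 0 j + 1]).
split=> [v|u v uv]; first by exists (a v).
split=> [Auv|[x [/= xu xv]]]; last first.
  have := xu (enum_rank u); have := xv (enum_rank u).
  rewrite !mxE enum_rankK /p eqxx (negbTE uv).
  by case: (adj u v) => //= /andP[h1 _] /andP[_ h2]; exfalso; lra.
exists (\row_j Num.max (a u 0 j) (a v 0 j)).
have le1 w : p w u <= p w v + 1 /\ p w v <= p w u + 1.
  rewrite /p; have [->|_] := eqVneq w u.
    by rewrite (negbTE uv) Auv; split; lra.
  have [->|_] := eqVneq w v; first by rewrite adj_sym Auv; split; lra.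
  by do 2 case: ifP => _; split; lra.
split=> j /=; have [h1 h2] := le1 (enum_val j);
  by rewrite !mxE le_max ge_max lexx ?orbT //=; apply/andP; split; lra.
Qed.

Lemma ex_cube_rep : exists k, `[< has_cube_rep k >].
Proof. by exists #|G|; apply/asboolP/has_cube_rep_card. Qed.

Lemma ex_box_rep : exists k, `[< has_box_rep k >].
Proof. by exists #|G|; apply/asboolP/has_cube_box_rep/has_cube_rep_card. Qed.

Definition boxicity : nat := ex_minn ex_box_rep.

Definition cubicity : nat := ex_minn ex_cube_rep.

End Representations.

(* Main.v *)
Require Import Defs.
From mathcomp Require Import all_boot all_order all_algebra.
From mathcomp Require Import boolp classical_sets reals.
From mathcomp Require Import lra.

(** Let m be the maximum of the c_i, and let p_i map each vertex of G_i to the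
lower corner of its cube in a representation of G_i in R^m.  The product of the
G_i is a spanning subgraph of the product of the K_(q_i).  Two vertices u, v
adjacent in the latter differ in a single coordinate i, so the sum p of the p_i
satisfies p(u) - p(v) = p_i(u_i) - p_i(v_i): among these pairs, the unit cubes
with corners p(u) and p(v) meet exactly when u_i and v_i are adjacent in G_i.
Hence m additional coordinates, carrying these cubes, turn a representation of
the product of the K_(q_i) into one of the product of the G_i. *)

Section CubeRefinement.

Import Order.TTheory GRing.Theory Num.Theory.
Local Open Scope ring_scope.
Local Open Scope classical_set_scope.

Variable R : realType.

Definition close {m} (x y : 'rV[R]_m) : bool :=
  [forall j, `|x 0 j - y 0 j| <= 1].

Definition unit_cube {m} (a : 'rV[R]_m) : set 'rV[R]_m :=
  [set x | forall j, a 0 j <= x 0 j <= a 0 j + 1].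

(** An explicit [phi] is needed because [G] and [H] may have different vertex types. The equation
    also covers [u = v], where irreflexivity makes both sides false. *)
Definition cube_refinement m (G H : sgraph) : Prop :=
  exists (phi : G -> H) (p : G -> 'rV[R]_m), injective phi /\
    forall u v, adj u v = adj (phi u) (phi v) && close (p u) (p v).

Lemma close_refl m (x : 'rV[R]_m) : close x x.
Proof. by apply/forallP => j; rewrite subrr normr0 ler01. Qed.

Lemma close_addl m (z x y : 'rV[R]_m) : close (z + x) (z + y) = close x y.
Proof. by apply: eq_forallb => j; rewrite !mxE opprD addrACA subrr add0r. Qed.

Lemma close_addr m (z x y : 'rV[R]_m) : close (x + z) (y + z) = close x y.
Proof. by rewrite ![_ + z]addrC close_addl. Qed.

Lemma unit_cubes_meet m (a b : 'rV[R]_m) :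
  (unit_cube a `&` unit_cube b !=set0) <-> close a b.
Proof.
split=> [[x [/= xa xb]]|/forallP ab].
  apply/forallP => j; move: (xa j) (xb j) => /andP[? ?] /andP[? ?].
  by rewrite ler_norml; apply/andP; split; lra.
exists (\row_j Num.max (a 0 j) (b 0 j)).
split=> j /=; have := ab j; rewrite ler_norml => /andP[? ?];
  by rewrite !mxE le_max ge_max lexx ?orbT //=; apply/andP; split; lra.
Qed.

Lemma cube_rep_corners G k : has_cube_rep R G k ->
  exists p : G -> 'rV[R]_k, forall u v, u != v -> adj u v = close (p u) (p v).
Proof.
case=> f [/choice[p fp] fi]; exists p => u v uv.
by apply/idP/idP; rewrite -unit_cubes_meet /unit_cube -!fp; apply fi.
Qed.

Lemma close_row_mx0 k l (x y : 'rV[R]_k) :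
  close (row_mx x 0 : 'rV_(k + l)) (row_mx y 0) = close x y.
Proof.
apply/forallP/forallP => xy j; first by have := xy (lshift l j); rewrite !row_mxEl.
by rewrite -(splitK j); case: (split j) => i /=;
  rewrite ?row_mxEl ?row_mxEr // mxE subrr normr0 ler01.
Qed.

Lemma cube_refinement_complete m G :
  (cubicity R G <= m)%N -> cube_refinement m G (complete #|G|).
Proof.
rewrite /cubicity; case: ex_minnP => k /asboolP/cube_rep_corners[p pP] _ km.
(* Cubes of the optimal dimension [k] are padded with [m - k] zero coordinates, so that all factors
   can share the dimension [m]. *)
rewrite -(subnKC km).
exists enum_rank, (fun u => row_mx (p u) 0); split=> [|u v]; first exact: enum_rank_inj.
rewrite close_row_mx0 /= /complete_adj (inj_eq enum_rank_inj).
by have [->|/pP] := eqVneq u v; first rewrite adj_irr.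
Qed.

(** Serves the factor [complete 1] that ends the iterated product; equal corners impose no
    constraint. *)
Lemma cube_refinement_refl m G : cube_refinement m G G.
Proof.
by exists id, (fun=> 0); split=> // u v; rewrite close_refl andbT.
Qed.

Lemma cube_refinement_cart m G1 H1 G2 H2 :
  cube_refinement m G1 H1 -> cube_refinement m G2 H2 ->
  cube_refinement m (cart G1 G2) (cart H1 H2).
Proof.
move=> [f1 [p1 [f1I p1P]]] [f2 [p2 [f2I p2P]]].
exists (fun u : G1 * G2 => (f1 u.1, f2 u.2) : cart H1 H2), (fun u => p1 u.1 + p2 u.2).
split=> [[u1 u2] [v1 v2] [/f1I -> /f2I ->] //|[u1 u2] [v1 v2]].
rewrite /= /cart_adj /= (inj_eq f1I) (inj_eq f2I) p1P p2P.
(* If one coordinate agrees, its summand is a common translation and cancels in [close]. If both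
   differ, neither product has an edge, whatever the sums are. *)
have [<-|_] := eqVneq u1 v1; first by rewrite adj_irr close_addl !orbF.
by have [<-|_] := eqVneq u2 v2; rewrite ?close_addr ?andbT ?andbF.
Qed.

Lemma cube_refinement_bigcart m d (G H : 'I_d -> sgraph) :
  (forall i, cube_refinement m (G i) (H i)) ->
  cube_refinement m (bigcart G) (bigcart H).
Proof.
move=> GH; rewrite /bigcart; apply: (big_ind2 (cube_refinement m)) => //.
  exact: cube_refinement_refl.
by move=> *; apply: cube_refinement_cart.
Qed.

Definition setX_row {m k} (A : set 'rV[R]_m) (B : set 'rV[R]_k) :
  set 'rV[R]_(m + k) := [set x | A (lsubmx x) /\ B (rsubmx x)].

Lemma setX_row_meet m k (A A' : set 'rV[R]_m) (B B' : set 'rV[R]_k) :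
  (setX_row A B `&` setX_row A' B' !=set0) <->
  (A `&` A' !=set0) /\ (B `&` B' !=set0).
Proof.
split=> [[x [[? ?] [? ?]]]|[[x [? ?]] [y [? ?]]]].
  by split; [exists (lsubmx x) | exists (rsubmx x)].
by exists (row_mx x y); rewrite /setX_row /= row_mxKl row_mxKr.
Qed.

Lemma row_forall m k (P : 'I_(m + k) -> Prop) :
  (forall j, P j) <-> (forall j, P (lshift k j)) /\ (forall j, P (rshift m j)).
Proof.
by split=> [//|[Pl Pr] j]; rewrite -(splitK j); case: (split j) => i /=.
Qed.

Lemma is_box_setX_row m k (A : set 'rV[R]_m) (B : set 'rV[R]_k) :
  is_box A -> is_box B -> is_box (setX_row A B).
Proof.
move=> [a [a' [aa' ->]]] [b [b' [bb' ->]]].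
exists (row_mx a b), (row_mx a' b'); split.
  by apply/row_forall; split=> j; rewrite ?row_mxEl ?row_mxEr.
apply/seteqP; split=> x /=; rewrite row_forall => -[xl xr];
  by split=> j; [move: (xl j) | move: (xr j)]; rewrite ?row_mxEl ?row_mxEr !mxE.
Qed.

Lemma is_cube_setX_row m k (A : set 'rV[R]_m) (B : set 'rV[R]_k) :
  is_cube A -> is_cube B -> is_cube (setX_row A B).
Proof.
move=> [a ->] [b ->]; exists (row_mx a b).
apply/seteqP; split=> x /=; rewrite row_forall => -[xl xr];
  by split=> j; [move: (xl j) | move: (xr j)]; rewrite ?row_mxEl ?row_mxEr !mxE.
Qed.

(** The two blocks of coordinates test the two conjuncts of adjacency separately. Injectivity of
    [phi] keeps distinct vertices distinct, as [f] only describes pairs of distinct vertices. *)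
Lemma intersection_rep_refinement m k (G H : sgraph) (phi : G -> H)
    (p : G -> 'rV[R]_m) (f : H -> set 'rV[R]_k) :
  injective phi ->
  (forall u v, adj u v = adj (phi u) (phi v) && close (p u) (p v)) ->
  intersection_rep f ->
  intersection_rep (fun u => setX_row (unit_cube (p u)) (f (phi u))).
Proof.
move=> phiI pP fi u v uv.
have puv : phi u != phi v by rewrite (inj_eq phiI).
rewrite setX_row_meet unit_cubes_meet -(fi _ _ puv) pP.
by split=> [/andP[]|[? ?]] //; apply/andP.
Qed.

Lemma boxicity_refinement m G H :
  cube_refinement m G H -> (boxicity R G <= m + boxicity R H)%N.
Proof.
move=> [phi [p [phiI pP]]]; rewrite /boxicity.
case: (ex_minnP (ex_box_rep R H)) => k /asboolP[f [fb fi]] _.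
(* By minimality of [n], it suffices to represent [G] in dimension [m + k], where [k] is the
   boxicity of [H]. *)
case: ex_minnP => n _; apply; apply/asboolP.
exists (fun u => setX_row (unit_cube (p u)) (f (phi u))); split=> [u|].
  by apply: is_box_setX_row => //; apply: is_cube_box; exists (p u).
exact: intersection_rep_refinement.
Qed.

Lemma cubicity_refinement m G H :
  cube_refinement m G H -> (cubicity R G <= m + cubicity R H)%N.
Proof.
move=> [phi [p [phiI pP]]]; rewrite /cubicity.
case: (ex_minnP (ex_cube_rep R H)) => k /asboolP[f [fc fi]] _.
case: ex_minnP => n _; apply; apply/asboolP.
exists (fun u => setX_row (unit_cube (p u)) (f (phi u))); split=> [u|].
  by apply: is_cube_setX_row => //; exists (p u).
exact: intersection_rep_refinement.
Qed.

End CubeRefinement.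

Theorem theorem4 (R : realType) (d : nat) (G : 'I_d -> sgraph)
    (q c : 'I_d -> nat)
    (hq : forall i : 'I_d, #|vertex (G i)| = q i)
    (hc : forall i : 'I_d, cubicity R (G i) = c i) :
  (boxicity R (bigcart G)
     <= \max_(i < d) c i + boxicity R (bigcart (fun i => complete (q i))))%N /\
  (cubicity R (bigcart G)
     <= \max_(i < d) c i + cubicity R (bigcart (fun i => complete (q i))))%N.
Proof.
have refine : cube_refinement R (\max_(i < d) c i) (bigcart G)
    (bigcart (fun i => complete (q i))).
  (* Factor by factor: [G i] refines the complete graph on its own vertices, with the maximum of the
     [c i] as common dimension. *)
  apply: cube_refinement_bigcart => i; rewrite -hq.
  by apply: cube_refinement_complete; rewrite hc leq_bigmax.
by split; [apply: boxicity_refinement | apply: cubicity_refinement].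
Qed.
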